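(* Let $N\ge3$, let $\mu$ be the uniform probability measure on $\mathbb Z/N\mathbb Z$, and let $L$ be the generator $L(z,z+1)=L(z,z-1)=1$, $L(z,z)=-2$, and $L(z,w)=0$ otherwise. Then the relative entropy $H(\cdot|\mu)$ satisfies the $0$-displacement convexity property: for all probability measures $\nu_0,\nu_1$ on $\mathbb Z/N\mathbb Z$, the Schrödinger bridge at zero temperature $(\widehat Q_t)_{t\in[0,1]}$ from $\nu_0$ to $\nu_1$ satisfies, for all $t\in(0,1)$, $$H(\widehat Q_t|\mu)\le(1-t)H(\nu_0|\mu)+t\,H(\nu_1|\mu).$$
   Context: $d$ is the graph distance on the cycle $\mathbb Z/N\mathbb Z$ (neighbours of $z$ are $z\pm1$), $[x,y]=\{z:d(x,z)+d(z,y)=d(x,y)\}$, and $H(q|\mu)=\sum_zq(z)\log\frac{q(z)}{\mu(z)}$ ($0\log0=0$). Schrödinger bridge at zero temperature. For $\gamma>0$, $t\ge0$ let $P_t^\gamma=e^{\gamma tL}$ and $P_t^\gamma f(x)=\sum_yP_t^\gamma(x,y)f(y)$. Let $f^\gamma,g^\gamma\ge0$ solve $f^\gamma(x)\,P_1^\gamma g^\gamma(x)=\nu_0(x)/\mu(x)$ and $g^\gamma(y)\,P_1^\gamma f^\gamma(y)=\nu_1(y)/\mu(y)$ for all $x,y$, and set $\widehat\pi^\gamma(x,y)=\mu(x)P_1^\gamma(x,y)f^\gamma(x)g^\gamma(y)$; this is a uniquely determined coupling of $\nu_0,\nu_1$ (the minimizer of the relative entropy with respect to $\mu(x)P_1^\gamma(x,y)$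 among couplings of $\nu_0$ and $\nu_1$). It is known (Léonard) that as $\gamma\to0$, $\widehat\pi^\gamma$ converges to a coupling $\widehat\pi$ of $\nu_0,\nu_1$, which is $W_1$-optimal (minimizes $\iint d\,d\pi$ among couplings). The bridge is $\widehat Q_t(z)=\sum_{x,y}Q_t^{x,y}(z)\,\widehat\pi(x,y)$ where $$Q_t^{x,y}(z)=\mathbf 1_{[x,y]}(z)\,\frac{L^{d(x,z)}(x,z)\,L^{d(z,y)}(z,y)}{L^{d(x,y)}(x,y)}\binom{d(x,y)}{d(x,z)}t^{d(x,z)}(1-t)^{d(z,y)},$$ $L^k$ denoting the $k$-th matrix power ($L^0$ the identity). Explicitly, $L^{d(x,y)}(x,y)=1$ unless $N$ is even and $d(x,y)=N/2$, in which case it equals $2$. *)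

(* Defs.v *)
From HB Require Import structures.
From mathcomp Require Import all_boot all_order all_algebra.
From mathcomp Require Import all_classical all_reals all_analysis.

Set Implicit Arguments.
Unset Strict Implicit.
Unset Printing Implicit Defensive.

Import Order.TTheory GRing.Theory Num.Theory.
Import numFieldNormedType.Exports.

Local Open Scope classical_set_scope.
Local Open Scope ring_scope.

(* The least length of an e-path from x to y. A shortest path has fewer than
   #|T| edges; the value is #|T| when y is not reachable from x. *)
Definition gdist (T : finType) (e : rel T) (x y : T) : nat :=
  find (fun k => [exists p : k.-tuple T, path e x p && (last x p == y)])
       (iota 0 #|T|).

(* 'Z_N is Z/NZ only for N > 1. *)
Definition cycle_adj (N : nat) : rel 'Z_N :=
  fun x y => (y == x + 1) || (y == x - 1).

Definition cycle_dist (N : nat) (x y : 'Z_N) : nat := gdist (@cycle_adj N) x y.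

Definition geodesic_interval (N : nat) (x y : 'Z_N) : pred 'Z_N :=
  [pred z | cycle_dist x z + cycle_dist z y == cycle_dist x y]%N.

(* 'Z_N is by definition 'I_(Zp_trunc N).+2, so elements of 'Z_N index the
   rows and columns. *)
Definition cycle_gen (R : realType) (N : nat) : 'M[R]_((Zp_trunc N).+2) :=
  \matrix_(z, w) (if w == z then - 2 else (cycle_adj (z : 'Z_N) w)%:R).

Definition cycle_unif (R : realType) (N : nat) : 'Z_N -> R := fun=> N%:R^-1.
Arguments cycle_unif : clear implicits.

Definition is_prob (R : realType) (T : finType) (nu : T -> R) : Prop :=
  (forall x, 0 <= nu x) /\ \sum_x nu x = 1.

(* Since ln is total, the terms with q z = 0 vanish. *)
Definition relative_entropy (R : realType) (T : finType) (q mu : T -> R) : R :=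
  \sum_z q z * ln (q z / mu z).

(* Matrix exponential: the exponential series, summed entrywise. *)
Definition expmx (R : realType) (n : nat) (A : 'M[R]_n.+1) : 'M[R]_n.+1 :=
  \matrix_(i, j) limn (series (fun k : nat => (A ^+ k) i j / k`!%:R)).

Definition semigroup (R : realType) (N : nat) (gamma t : R) :
    'M[R]_((Zp_trunc N).+2) :=
  expmx ((gamma * t) *: cycle_gen R N).

Arguments semigroup : clear implicits.

Definition apply_mx (R : realType) (N : nat) (P : 'M[R]_((Zp_trunc N).+2))
    (f : 'Z_N -> R) : 'Z_N -> R :=
  fun x => \sum_(y : 'Z_N) P x y * f y.

Definition schrodinger_system (R : realType) (N : nat) (gamma : R)
    (nu0 nu1 f g : 'Z_N -> R) : Prop :=
  [/\ forall x, 0 <= f x,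
      forall y, 0 <= g y,
      forall x, f x * apply_mx (semigroup R N gamma 1) g x
                = nu0 x / cycle_unif R N x &
      forall y, g y * apply_mx (semigroup R N gamma 1) f y
                = nu1 y / cycle_unif R N y].

Definition schrodinger_coupling (R : realType) (N : nat) (gamma : R)
    (f g : 'Z_N -> R) : 'Z_N -> 'Z_N -> R :=
  fun x y => cycle_unif R N x * semigroup R N gamma 1 x y * f x * g y.

(* The system determines f and g up to reciprocal scalars, so the coupling, and
   hence pihat, does not depend on the choice of f and g. *)
Definition is_zero_temperature_coupling (R : realType) (N : nat)
    (nu0 nu1 : 'Z_N -> R) (pihat : 'Z_N -> 'Z_N -> R) : Prop :=
  exists f g : R -> 'Z_N -> R,
    (forall gamma : R, 0 < gamma ->
       schrodinger_system gamma nu0 nu1 (f gamma) (g gamma)) /\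
    (forall x y,
       schrodinger_coupling gamma (f gamma) (g gamma) x y
         @[gamma --> (0 : R)^'+] --> pihat x y).

Definition pinned_bridge (R : realType) (N : nat) (x y : 'Z_N) (t : R)
    (z : 'Z_N) : R :=
  let L := cycle_gen R N in
  let d := @cycle_dist N in
  (z \in geodesic_interval x y)%:R
  * ((L ^+ d x z) x z * (L ^+ d z y) z y / (L ^+ d x y) x y)
  * 'C(d x y, d x z)%:R * t ^+ d x z * (1 - t) ^+ d z y.

Definition is_zero_temperature_bridge (R : realType) (N : nat)
    (nu0 nu1 : 'Z_N -> R) (Qhat : R -> 'Z_N -> R) : Prop :=
  exists pihat : 'Z_N -> 'Z_N -> R,
    is_zero_temperature_coupling nu0 nu1 pihat /\
    forall t, 0 <= t <= 1 -> forall z,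
      Qhat t z =
        \sum_(x : 'Z_N) \sum_(y : 'Z_N) pinned_bridge x y t z * pihat x y.

(* Main.v *)
Require Import Defs.
From mathcomp Require Import all_boot all_order all_algebra.
From mathcomp Require Import all_classical all_reals all_analysis.
From mathcomp Require Import ring lra.

(** The entropy is already convex along the Schrodinger bridge at small positive
    temperature, and the theorem is the limit of that inequality.

    Fix gamma > 0 small enough for the entries of P_t to be positive, and write
    u_t = P_t f, v_t = P_(1-t) g, so that the bridge at temperature gamma is
    Q_t = mu u_t v_t and, mu being uniform, its entropy is the mean of
    (u v) ln (u v) = v (u ln u) + u (v ln v). Time reversal exchanges f and g and
    the two summands, so it is enough that
    A(t) = sum_z v_t(z) u_t(z) ln u_t(z) is convex. As u solves the heat equation
    and v the backward one, summation by parts gives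
      A' = - gamma sum_z v(z) psi(z),
      A'' = gamma^2 sum_z v(z) (Delta psi - D psi[Delta u])(z),
    where psi(z) sums J(a, b) = b ln (b / a) - b + a, with a = u(z) and
    b = u(z + 1) or u(z - 1), over the two neighbours of z. The integrand of A''
    is pointwise nonnegative: translations commute with Delta, so the logarithms
    combine in such a way that only ln x <= x - 1 is used
    (entropy_jump_bochner). Hence A lies below its chord
    (half_entropy_le_chord), and so does the entropy of Q_t, whose values at
    t = 0 and t = 1 are exactly those of nu0 and nu1
    (schrodinger_entropy_le_chord).

    It remains to let gamma tend to 0. The bridge is the mixture, under the
    Schrodinger coupling, of the kernels P_t(x,z) P_(1-t)(z,y) / P_1(x,y). The
    entry (x, y) of L^k vanishes for k < d(x,y) and is positive for k = d(x,y),
    so P_t(x,y) is equivalent to (gamma t)^d L^d(x,y) / d! with d = d(x,y), and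
    the kernels converge to the pinned bridges (pinned_bridge_cvg): the power of
    gamma left over is d(x,z) + d(z,y) - d(x,y), which kills every z off the
    geodesics. Since x ln x is continuous, the entropies converge and the
    inequality survives. *)

Set Implicit Arguments.
Unset Strict Implicit.
Unset Printing Implicit Defensive.

Import Order.TTheory GRing.Theory Num.Theory.
Import numFieldNormedType.Exports.

Local Open Scope classical_set_scope.
Local Open Scope ring_scope.

(** * Entire power series and the matrix exponential *)

Lemma cvg_finsum (R : realType) (T : Type) (F : set_system T) (I : finType)
    (h : I -> T -> R) (l : I -> R) : Filter F ->
  (forall i, (h i x @[x --> F] --> l i)%classic) ->
  (\sum_i h i x @[x --> F] --> \sum_i l i)%classic.
Proof. by move=> FF hl; apply: cvg_big => //; exact: add_continuous. Qed.

(** Domination by the coefficients of M exp(C x): a class of entire series that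
    contains the entries of a matrix exponential and is closed under term by term
    differentiation and under shifts. *)
Definition exp_bounded (R : realType) (c : nat -> R) : Prop :=
  exists M C : R, [/\ 0 <= M, 0 <= C & forall k, `|c k| <= M * (C ^+ k / k`!%:R)].

Lemma exp_bounded_cvg (R : realType) (c : nat -> R) (x : R) :
  exp_bounded c -> cvgn (pseries c x).
Proof.
move=> [M [C [M0 C0 cMC]]]; apply: normed_cvg.
apply: (@series_le_cvg _ _ (M *: exp_coeff (C * `|x|))) => [n|n|n|].
- exact: normr_ge0.
- by rewrite /exp_coeff /= mulr_ge0 ?divr_ge0 ?exprn_ge0 ?mulr_ge0.
- rewrite /= normrM normrX /exp_coeff /=.
  have -> : (M *: (fun n => (C * `|x|) ^+ n / n`!%:R)) n
            = M * (C ^+ n / n`!%:R) * `|x| ^+ n.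
    by change (M * ((C * `|x|) ^+ n / n`!%:R) = M * (C ^+ n / n`!%:R) * `|x| ^+ n);
       rewrite exprMn; ring.
  by rewrite ler_wpM2r ?exprn_ge0.
- exact/is_cvg_seriesZ/is_cvg_series_exp_coeff.
Qed.

Lemma exp_bounded_diffs (R : realType) (c : nat -> R) :
  exp_bounded c -> exp_bounded (pseries_diffs c).
Proof.
move=> [M [C [M0 C0 cMC]]]; exists (M * C), C; split=> //; first exact: mulr_ge0.
move=> k; rewrite /pseries_diffs normrM ger0_norm//.
apply: (le_trans (ler_wpM2l _ (cMC k.+1))) => //.
rewrite le_eqVlt; apply/orP; left; apply/eqP.
rewrite exprS factS natrM; field.
by rewrite nat1r !pnatr_eq0 -lt0n fact_gt0.
Qed.

Lemma exp_bounded_shift (R : realType) (d : nat) (c : nat -> R) :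
  exp_bounded c -> exp_bounded (fun k => c (d + k)%N).
Proof.
move=> [M [C [M0 C0 cMC]]].
exists (M * C ^+ d), C; split=> //; first by rewrite mulr_ge0 ?exprn_ge0.
move=> k; apply: (le_trans (cMC _)).
rewrite exprD -!mulrA ler_wpM2l// ler_wpM2l ?exprn_ge0//.
rewrite ler_wpM2l ?exprn_ge0// lef_pV2 ?posrE ?ltr0n ?fact_gt0// ler_nat.
by elim: d => // d IH; rewrite addSn factS (leq_trans IH)// leq_pmull.
Qed.

Lemma is_derive_entire (R : realType) (c : nat -> R) (x : R) :
  exp_bounded c ->
  is_derive x 1 (fun t : R => limn (pseries c t)) (limn (pseries (pseries_diffs c) x)).
Proof.
move=> cb; apply: (@pseries_snd_diffs _ c (`|x| + 1)).
- exact: exp_bounded_cvg.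
- exact/exp_bounded_cvg/exp_bounded_diffs.
- exact/exp_bounded_cvg/exp_bounded_diffs/exp_bounded_diffs.
- by rewrite [ltRHS]ger0_norm ?addr_ge0// ltrDl.
Qed.

Lemma pseries_at0 (R : realType) (c : nat -> R) : limn (pseries c 0) = c 0%N.
Proof.
apply: cvg_lim => //; rewrite -cvg_shiftS /=.
rewrite (_ : (fun n => _) = fun=> c 0%N); first exact: cvg_cst.
apply/funext => n; rewrite /pseries /series /= big_nat_recl//= expr0 mulr1.
by rewrite big1 ?addr0// => i _; rewrite exprS mul0r mulr0.
Qed.

Lemma pseries_factor (R : realType) (d : nat) (c : nat -> R) (t : R) :
  exp_bounded c -> (forall k, (k < d)%N -> c k = 0) ->
  limn (pseries c t) = t ^+ d * limn (pseries (fun k => c (d + k)%N) t).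
Proof.
move=> cb c0; apply: cvg_lim => //.
rewrite -(cvg_shiftn d).
rewrite (_ : (fun n => _)
  = (fun n => t ^+ d * pseries (fun k => c (d + k)%N) t n)); last first.
  apply/funext => n; rewrite /pseries /series /= addnC !big_mkord big_split_ord/=.
  rewrite big1 ?add0r => [|i _]; last by rewrite c0 ?mul0r.
  by rewrite mulr_sumr; apply: eq_bigr => i _; rewrite exprD mulrCA.
by apply: cvgMr; exact/exp_bounded_cvg/exp_bounded_shift.
Qed.

Definition expmx_coef (R : realType) (n : nat) (A : 'M[R]_n.+1) (i j : 'I_n.+1)
  (k : nat) : R := (A ^+ k) i j / k`!%:R.

(** The sum C of the absolute values of all entries of A dominates every row
    sum, so the entries of A^k are at most C^k. *)
Lemma expmx_coef_bounded (R : realType) (n : nat) (A : 'M[R]_n.+1)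
    (i j : 'I_n.+1) : exp_bounded (expmx_coef A i j).
Proof.
pose C := \sum_a \sum_b `|A a b|.
have C0 : 0 <= C by apply: sumr_ge0 => a _; exact: sumr_ge0.
exists 1, C; split=> // k; rewrite mul1r normrM normfV normr_nat.
rewrite ler_wpM2r ?invr_ge0//; elim: k i => [|k IH] i.
  by rewrite !expr0 mxE; case: eqP => _; rewrite ?normr1 ?normr0.
rewrite exprS mxE (le_trans (ler_norm_sum _ _ _))// exprS.
apply: (@le_trans _ _ (\sum_l `|A i l| * C ^+ k)).
  by apply: ler_sum => l _; rewrite normrM ler_wpM2l.
rewrite -mulr_suml ler_wpM2r ?exprn_ge0// /C [leRHS](bigD1 i)//= lerDl.
by apply: sumr_ge0 => a _; exact: sumr_ge0.
Qed.

Lemma expmxZE (R : realType) (n : nat) (A : 'M[R]_n.+1) (t : R) (i j : 'I_n.+1) :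
  expmx (t *: A) i j = limn (pseries (expmx_coef A i j) t).
Proof.
rewrite mxE /pseries; congr (limn (series _)); apply/funext => k.
rewrite /expmx_coef.
have -> : (t *: A) ^+ k = t ^+ k *: A ^+ k.
  by elim: k => [|k IH]; rewrite ?expr0 ?scale1r// !exprS IH -scalerAl -scalerAr scalerA.
by rewrite mxE /=; ring.
Qed.

Lemma is_derive_expmx (R : realType) (n : nat) (A : 'M[R]_n.+1) (t : R)
    (i j : 'I_n.+1) :
  is_derive t 1 (fun s : R => expmx (s *: A) i j)
    (\sum_l A i l * expmx (t *: A) l j).
Proof.
have -> : (fun s : R => expmx (s *: A) i j)
          = (fun s : R => limn (pseries (expmx_coef A i j) s)).
  by apply/funext => s; rewrite expmxZE.
apply: (is_derive_eq (is_derive_entire t (expmx_coef_bounded A i j))).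
under [RHS]eq_bigr do rewrite expmxZE.
apply: cvg_lim => //.
rewrite (_ : pseries _ _
  = (fun m => \sum_l A i l * pseries (expmx_coef A l j) t m)).
  apply: cvg_finsum => l; apply: cvgMr; exact/exp_bounded_cvg/expmx_coef_bounded.
apply/funext => m; rewrite /pseries /series /=.
under [RHS]eq_bigr do rewrite mulr_sumr.
rewrite exchange_big; apply: eq_bigr => k _ /=.
rewrite /pseries_diffs /expmx_coef exprS mxE mulr_suml mulr_sumr mulr_suml.
apply: eq_bigr => l _; rewrite factS natrM; field.
by rewrite nat1r !pnatr_eq0 -lt0n fact_gt0.
Qed.

Lemma expmx0 (R : realType) (n : nat) : expmx (0 : 'M[R]_n.+1) = 1.
Proof.
apply/matrixP => i j.
by rewrite -(scale0r (1 : 'M[R]_n.+1)) expmxZE pseries_at0 /expmx_coef expr0 divr1.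
Qed.

(** The first possibly nonzero term of the exponential series governs it near 0:
    what remains after dividing by s^d is a power series, continuous at 0. *)
Lemma expmx_leading (R : realType) (n d : nat) (A : 'M[R]_n.+1) (i j : 'I_n.+1) :
  (forall k, (k < d)%N -> (A ^+ k) i j = 0) ->
  (expmx (s *: A) i j / s ^+ d @[s --> (0 : R)^'+]
     --> (A ^+ d) i j / d`!%:R)%classic.
Proof.
move=> A0.
set c := expmx_coef A i j.
have cb : exp_bounded (fun k => c (d + k)%N).
  exact/exp_bounded_shift/expmx_coef_bounded.
have -> : (A ^+ d) i j / d`!%:R = limn (pseries (fun k => c (d + k)%N) 0).
  by rewrite pseries_at0 addn0.
have cont : {for 0, continuous (fun s : R => limn (pseries (fun k => c (d + k)%N) s))}.
  apply: differentiable_continuous; apply/derivable1_diffP.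
  exact: (@ex_derive _ _ _ _ _ _ _ (is_derive_entire 0 cb)).
apply: cvg_trans (_ : _ --> _)%classic; last exact: (cvg_at_right_filter cont).
apply: near_eq_cvg; near=> s.
have s0 : 0 < s by near: s; exact: nbhs_right_gt.
rewrite expmxZE (pseries_factor (d := d) s (expmx_coef_bounded A i j)).
  by rewrite mulrC mulKf// expf_neq0// gt_eqF.
by move=> k kd; rewrite /expmx_coef A0// mul0r.
Unshelve. all: by end_near.
Qed.

(** * Walks on the cycle and powers of the generator *)

Definition walk (N k : nat) (x y : 'Z_N) : Prop :=
  exists p : seq 'Z_N, [/\ size p = k, path (@cycle_adj N) x p & last x p = y].

Lemma walkS (N k : nat) (x y z : 'Z_N) :
  cycle_adj x z -> walk k z y -> walk k.+1 x y.
Proof.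
by move=> xz [p [<- zp lp]]; exists (z :: p); split=> //=; rewrite xz.
Qed.

Lemma walk_cat (N j k : nat) (x z y : 'Z_N) :
  walk j x z -> walk k z y -> walk (j + k) x y.
Proof.
move=> [p [<- xp lp]] [q [<- zq lq]]; exists (p ++ q).
by rewrite size_cat cat_path last_cat xp lp zq lq.
Qed.

Lemma walk_natr (N k : nat) (x : 'Z_N) : walk k x (x + k%:R).
Proof.
elim: k x => [|k IH] x; first by exists [::]; rewrite /= addr0.
apply: (@walkS _ _ _ _ (x + 1)); first by rewrite /cycle_adj eqxx.
by have := IH (x + 1); rewrite -addrA nat1r.
Qed.

Lemma walkP (N k : nat) (x y : 'Z_N) :
  reflect (walk k x y)
    [exists p : k.-tuple 'Z_N, path (@cycle_adj N) x p && (last x p == y)].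
Proof.
apply: (iffP existsP) => [[p /andP[xp /eqP lp]]|[p [sp xp lp]]].
  by exists p; rewrite size_tuple.
have /eqP sp' := sp; exists (Tuple sp'); by rewrite /= xp lp eqxx.
Qed.

(** Going round in one direction reaches every vertex in fewer steps than there
    are vertices, hence within the range over which the distance is searched. *)
Lemma walk_dist (N : nat) (x y : 'Z_N) : walk (cycle_dist x y) x y.
Proof.
apply/walkP; rewrite /cycle_dist /gdist; set P := fun k => _.
have hasP : has P (iota 0 #|'Z_N|).
  apply/hasP; exists (val (y - x)); first by rewrite mem_iota add0n card_ord; exact: ltn_ord.
  apply/walkP; have := walk_natr (val (y - x)) x.
  by rewrite natr_Zp subrKC.
have := nth_find 0%N hasP; rewrite nth_iota ?add0n //.
by rewrite -[ltnRHS](size_iota 0) -has_find.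
Qed.

Lemma dist_le_walk (N k : nat) (x y : 'Z_N) : walk k x y -> (cycle_dist x y <= k)%N.
Proof.
move=> /walkP w; rewrite leqNgt; apply/negP; rewrite /cycle_dist /gdist => kd.
have := before_find 0%N kd; rewrite nth_iota ?add0n ?w//.
by rewrite (leq_trans kd)// -[leqRHS](size_iota 0) find_size.
Qed.

Lemma cycle_dist_triangle (N : nat) (x z y : 'Z_N) :
  (cycle_dist x y <= cycle_dist x z + cycle_dist z y)%N.
Proof. exact/dist_le_walk/walk_cat/walk_dist/walk_dist. Qed.

Lemma cycle_adj_sym (N : nat) (x y : 'Z_N) : cycle_adj x y = cycle_adj y x.
Proof.
rewrite /cycle_adj orbC; congr (_ || _); last by rewrite [RHS]eq_sym subr_eq.
by rewrite [LHS]eq_sym subr_eq.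
Qed.

Lemma cycle_gen_sym (R : realType) (N k : nat) (x y : 'Z_N) :
  (cycle_gen R N ^+ k) x y = (cycle_gen R N ^+ k) y x.
Proof.
suff E : (cycle_gen R N ^+ k)^T = cycle_gen R N ^+ k by rewrite -[in LHS]E mxE.
elim: k => [|k IH]; first by rewrite !expr0 trmx1.
rewrite [in LHS]exprS trmx_mul IH exprSr; congr (_ * _).
by apply/matrixP => i j; rewrite !mxE eq_sym cycle_adj_sym.
Qed.

(** Expanding L^(k+1)(x, y) along the first step, the diagonal entry -2
    multiplies L^k(x, y), which is zero because k < d(x, y); all other terms are
    nonnegative. Up to k = d(x, y), the power therefore detects the walks of
    length k. *)
Lemma cycle_gen_power_ge0 (R : realType) (N k : nat) (x y : 'Z_N) :
  (k <= cycle_dist x y)%N ->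
  0 <= (cycle_gen R N ^+ k) x y ?= iff ~~ `[< walk k x y >].
Proof.
elim: k x => [|k IH] x kd.
  rewrite expr0 mxE; case: eqP => [->|xy].
    rewrite asboolT; last by exists [::].
    by split; rewrite ?ler01// eq_sym oner_eq0.
  rewrite asboolF; first by split; rewrite ?lexx ?eqxx.
  by move=> [p [/eqP]]; rewrite size_eq0 => /eqP-> _ /= /xy.
have kdw w : cycle_adj x w -> (k <= cycle_dist w y)%N.
  move=> xw; rewrite -ltnS (leq_trans kd)//.
  exact/dist_le_walk/(walkS xw)/walk_dist.
have Lx : (cycle_gen R N ^+ k) x y = 0.
  have [_] := IH x (ltnW kd); case: asboolP => [/dist_le_walk|_].
    by rewrite leqNgt kd.
  by rewrite eq_sym => /eqP.
have term_ge0 (w : 'Z_N) : 0 <= cycle_gen R N x w * (cycle_gen R N ^+ k) w y.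
  have [->|wx] := eqVneq w x; first by rewrite Lx mulr0.
  rewrite mxE (negbTE wx); case: (boolP (cycle_adj x w)) => xw /=; last by rewrite mul0r.
  by rewrite mul1r (IH _ (kdw _ xw)).
rewrite exprS mxE; split; first by apply: sumr_ge0 => w _.
rewrite eq_sym psumr_eq0//; apply/allP/idP => [all0|nw w _].
  apply/asboolP => -[[|w p] [//= [sp] /andP[xw wp] lp]].
  have /implyP/(_ isT) := all0 w (mem_index_enum w).
  rewrite mulf_eq0 mxE.
  have wk : walk k w y by exists p.
  have [_] := IH w (kdw _ xw); rewrite asboolT// eq_sym /= => ->; rewrite orbF.
  case: (eqVneq w x) => [wx|_]; last by rewrite xw oner_eq0.
  by move: (dist_le_walk wk); rewrite wx leqNgt kd.
apply/implyP => _; rewrite mulf_eq0.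
have [->|wx] := eqVneq w x; first by rewrite Lx eqxx orbT.
rewrite mxE (negbTE wx); case: (boolP (cycle_adj x w)) => xw; last by rewrite eqxx.
have [_] := IH w (kdw _ xw); rewrite eq_sym => ->; apply/orP; right.
by apply/asboolP => wk; move/asboolP: nw; apply; exact: walkS xw wk.
Qed.

Lemma cycle_gen_power_lt_dist (R : realType) (N k : nat) (x y : 'Z_N) :
  (k < cycle_dist x y)%N -> (cycle_gen R N ^+ k) x y = 0.
Proof.
move=> kd; have [_] := cycle_gen_power_ge0 R (ltnW kd).
rewrite asboolF; first by rewrite eq_sym => /eqP.
by move=> /dist_le_walk; rewrite leqNgt kd.
Qed.

Lemma cycle_gen_power_dist_gt0 (R : realType) (N : nat) (x y : 'Z_N) :
  0 < (cycle_gen R N ^+ cycle_dist x y) x y.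
Proof.
have [p0] := cycle_gen_power_ge0 R (leqnn (cycle_dist x y)).
by rewrite asboolT ?lt_def ?p0; [rewrite andbT eq_sym => -> | exact: walk_dist].
Qed.

(** For N >= 3 the vertices z, z + 1 and z - 1 are distinct, so that each
    contributes its own matrix entry. *)
Lemma apply_cycle_gen (R : realType) (N : nat) (h : 'Z_N -> R) (z : 'Z_N) :
  (3 <= N)%N ->
  apply_mx (cycle_gen R N) h z = h (z + 1) + h (z - 1) - 2 * h z.
Proof.
move=> hN.
have nz (m : nat) : (0 < m < 3)%N -> (m%:R : 'Z_N) != 0.
  move=> /andP[m0 m3]; apply/eqP => /(congr1 (@nat_of_ord _)).
  rewrite val_Zp_nat ?(leq_trans _ hN)//= modn_small ?(leq_trans m3)// => E.
  by rewrite E in m0.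
have n1 : z + 1 != z by rewrite addrC -subr_eq0 addrK (nz 1%N).
have n2 : z - 1 != z by rewrite addrC -subr_eq0 addrK oppr_eq0 (nz 1%N).
have n3 : z - 1 != z + 1.
  rewrite eq_sym -subr_eq0 (_ : _ - _ = 2%:R); first exact: (nz 2).
  by ring.
rewrite /apply_mx (bigD1 z)//= (bigD1 (z + 1))//= (bigD1 (z - 1))/=; last by rewrite n2.
rewrite big1 => [|w /andP[/andP[wz w1] w2]]; last first.
  by rewrite mxE (negbTE wz) /cycle_adj (negbTE w1) (negbTE w2) mul0r.
rewrite !mxE eqxx (negbTE n1) (negbTE n2) /cycle_adj !eqxx orbT /=.
by ring.
Qed.

Definition heat_flow (R : realType) (N : nat) (gamma : R)
    (f : 'Z_N -> R) (t : R) : 'Z_N -> R :=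
  apply_mx (semigroup R N gamma t) f.

Lemma is_derive_finsum (R : realType) (I : finType) (F : I -> R -> R)
    (dF : I -> R) (t : R) :
  (forall i, is_derive t 1 (F i) (dF i)) ->
  is_derive t 1 (fun s => \sum_i F i s) (\sum_i dF i).
Proof.
move=> dFi; rewrite (_ : (fun s => _) = \sum_i F i); last first.
  by apply/funext => s; rewrite fct_sumE.
elim/big_ind2 : _ => // [|f df g dg ? ?]; [exact: is_derive_cst|exact: is_deriveD].
Qed.

(** The heat equation, read off from the series of the kernel. *)
Lemma is_derive_heat_flow (R : realType) (N : nat) (gamma t : R)
    (f : 'Z_N -> R) (z : 'Z_N) : (3 <= N)%N ->
  is_derive t 1 (fun s => heat_flow gamma f s z)
    (gamma * (heat_flow gamma f t (z + 1) + heat_flow gamma f t (z - 1)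
              - 2 * heat_flow gamma f t z)).
Proof.
move=> hN; rewrite -apply_cycle_gen//.
rewrite /heat_flow /semigroup /apply_mx.
have -> : (fun s => \sum_y expmx ((gamma * s) *: cycle_gen R N) z y * f y)
   = (fun s => \sum_y expmx (s *: (gamma *: cycle_gen R N)) z y * f y).
  by apply/funext => s; apply: eq_bigr => y _; rewrite scalerA [s * _]mulrC.
have D (y : 'Z_N) := is_deriveM (is_derive_expmx (gamma *: cycle_gen R N) t z y)
                      (is_derive_cst (f y) t 1).
apply: (is_derive_eq (is_derive_finsum D)).
rewrite [RHS]mulr_sumr.
under [RHS]eq_bigr do rewrite mulrA mulr_sumr.
rewrite [RHS]exchange_big; apply: eq_bigr => y _ /=.
rewrite scaler0 add0r scaler_sumr; apply: eq_bigr => w _.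
have -> : (gamma *: cycle_gen R N) z w = gamma * cycle_gen R N z w by rewrite mxE.
rewrite scalerA [t * gamma]mulrC.
by set p := expmx _ w y; rewrite /GRing.scale/=; ring.
Qed.

Lemma heat_flow0 (R : realType) (N : nat) (gamma : R) (f : 'Z_N -> R) :
  heat_flow gamma f 0 = f.
Proof.
apply/funext => x; rewrite /heat_flow /apply_mx /semigroup mulr0 scale0r expmx0.
rewrite (bigD1 x)//= mxE eqxx mul1r big1 ?addr0// => y yx.
by rewrite mxE eq_sym (negbTE yx) mul0r.
Qed.

Lemma heat_kernel_sym (R : realType) (N : nat) (gamma t : R) (x y : 'Z_N) :
  semigroup R N gamma t x y = semigroup R N gamma t y x.
Proof.
rewrite /semigroup !expmxZE; congr (limn (pseries _ _)).
by apply/funext => k; rewrite /expmx_coef cycle_gen_sym.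
Qed.


Lemma cvg_at_right_scale (R : realType) (t : R) : 0 < t ->
  (g * t @[g --> (0 : R)^'+] --> (0 : R)^'+)%classic.
Proof.
move=> t0.
have c : (g * t @[g --> (0 : R)^'+] --> (0 : R))%classic.
  rewrite -[X in (_ --> X)%classic](mul0r t).
  exact: (cvg_at_right_filter (@mulrr_continuous _ t 0)).
move=> A A0; rewrite -[_ A]/(\forall g \near (0 : R)^'+, A (g * t)); near=> g.
have : 0 < g * t by rewrite mulr_gt0//; near: g; exact: nbhs_right_gt.
by near: g; exact: (c _ A0).
Unshelve. all: by end_near.
Qed.

Lemma expmx_cycle_gen_leading (R : realType) (N : nat) (x y : 'Z_N) :
  (expmx (s *: cycle_gen R N) x y / s ^+ cycle_dist x y @[s --> (0 : R)^'+]
     --> (cycle_gen R N ^+ cycle_dist x y) x y / (cycle_dist x y)`!%:R)%classic.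
Proof. by apply: expmx_leading => k; exact: cycle_gen_power_lt_dist. Qed.

Lemma heat_kernel_leading (R : realType) (N : nat) (t : R) (x y : 'Z_N) : 0 < t ->
  (semigroup R N gamma t x y / gamma ^+ cycle_dist x y @[gamma --> (0 : R)^'+]
     --> t ^+ cycle_dist x y
         * ((cycle_gen R N ^+ cycle_dist x y) x y / (cycle_dist x y)`!%:R))%classic.
Proof.
move=> t0.
have lead := cvg_comp _ _ (cvg_at_right_scale t0) (@expmx_cycle_gen_leading R N x y).
apply: cvg_trans (_ : _ --> _); last exact: cvgM (cvg_cst _) lead.
apply: near_eq_cvg; near=> g.
have g0 : 0 < g by near: g; exact: nbhs_right_gt.
rewrite /= /semigroup exprMn; field.
by rewrite !expf_neq0// gt_eqF.
Unshelve. all: by end_near.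
Qed.

(** The kernel depends on gamma and t through gamma * t only, so positivity of
    the leading term near 0 gives positivity for small gamma, uniformly in
    t <= 1. *)
Lemma heat_kernel_gt0 (R : realType) (N : nat) :
  exists2 g0 : R, 0 < g0 & forall gamma t, 0 < gamma < g0 -> 0 < t <= 1 ->
    forall x y : 'Z_N, 0 < semigroup R N gamma t x y.
Proof.
have pos : \forall s \near (0 : R)^'+, forall xy : 'Z_N * 'Z_N,
    0 < expmx (s *: cycle_gen R N) xy.1 xy.2.
  apply: filter_forall => -[x y] /=; near=> s.
  have s0 : 0 < s by near: s; exact: nbhs_right_gt.
  have : 0 < expmx (s *: cycle_gen R N) x y / s ^+ cycle_dist x y.
    near: s; apply: (cvgr_gt _ (@expmx_cycle_gen_leading R N x y)).
    by rewrite divr_gt0 ?cycle_gen_power_dist_gt0// ltr0n fact_gt0.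
  by rewrite pmulr_lgt0// invr_gt0 exprn_gt0.
have [e /= e0 He] := pos; exists e => // g t /andP[g0 ge] /andP[t0 t1] x y.
have gt0 : 0 < g * t by rewrite mulr_gt0.
apply: (He (g * t) _ gt0 (x, y)) => /=.
rewrite sub0r normrN gtr0_norm// (le_lt_trans _ ge)//.
by rewrite ler_piMr// ltW.
Unshelve. all: by end_near.
Qed.

(** * Convexity of x ln x along the heat flow *)

Definition xlnx (R : realType) (x : R) : R := x * ln x.

(** From ln y < y at y = 1 / sqrt x. *)
Lemma normr_xlnx_le (R : realType) (x : R) : x <= 1 ->
  `|xlnx x| <= 2 * Num.sqrt x.
Proof.
move=> x1; rewrite /xlnx; have [x0|x0] := leP x 0.
  by rewrite ln0// mulr0 normr0 mulr_ge0// sqrtr_ge0.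
rewrite ler0_norm; last by rewrite mulr_ge0_le0 ?ln_le0// ltW.
have s0 : 0 < Num.sqrt x by rewrite sqrtr_gt0.
have := @ln_sublinear _ (Num.sqrt x)^-1; rewrite invr_gt0 s0 => /(_ isT).
rewrite lnV ?posrE// => /ltW ls.
rewrite -{1 2}(sqr_sqrtr (ltW x0)) lnXn//.
have -> : - (Num.sqrt x ^+ 2 * (ln (Num.sqrt x) *+ 2))
   = 2 * Num.sqrt x ^+ 2 * (- ln (Num.sqrt x)) by ring.
apply: (le_trans (ler_wpM2l _ ls)); first by rewrite mulr_ge0// exprn_ge0// ltW.
by rewrite le_eqVlt; apply/orP; left; apply/eqP; field; rewrite gt_eqF.
Qed.

(** Continuity holds on the whole line, as ln vanishes on the nonpositive
    numbers; this covers endpoints of the time interval at which the flow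
    vanishes. *)
Lemma xlnx_continuous (R : realType) : continuous (@xlnx R).
Proof.
move=> x; have [x0|x0|->] := ltgtP x 0.
- apply: cvg_trans (_ : (fun=> 0 : R) @ x --> _)%classic; last first.
    by rewrite /xlnx ln0 ?ltW// mulr0; exact: cvg_cst.
  apply: near_eq_cvg; near=> y; have y0 : y < 0 by near: y; exact: lt_nbhsl.
  by rewrite /xlnx ln0 ?ltW// mulr0.
- by apply: continuousM; [exact: cvg_id | exact: continuous_ln].
rewrite /continuous_at; have -> : xlnx 0 = 0 :> R by rewrite /xlnx mul0r.
apply/cvgr0Pnorm_lt => e e0; near=> y.
have y1 : y <= 1 by near: y; exact: (cvgr_le _ (@cvg_id _ (nbhs (0 : R)))).
apply: (le_lt_trans (normr_xlnx_le y1)).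
have : Num.sqrt y < e / 2.
  near: y; apply: (cvgr_lt _ (@sqrt_continuous R 0)).
  by rewrite sqrtr0 divr_gt0.
by rewrite ltr_pdivlMr// mulrC.
Unshelve. all: by end_near.
Qed.

(** Convexity from a nonnegative second derivative. The derivatives are required
    in the open interval only, because at t = 0 and t = 1 the densities may
    vanish and x ln x is not differentiable there. *)
Lemma le_chord (R : realType) (f f1 f2 : R -> R) (t : R) :
  0 < t < 1 -> continuous f ->
  (forall x : R, 0 < x < 1 -> is_derive x 1 f (f1 x)) ->
  (forall x : R, 0 < x < 1 -> is_derive x 1 f1 (f2 x)) ->
  (forall x : R, 0 < x < 1 -> 0 <= f2 x) ->
  f t <= (1 - t) * f 0 + t * f 1.
Proof.
move=> /andP[t0 t1] fc df df1 f2ge0.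
have [a /= + fa] : exists2 a, a \in `]0, t[%R & f t - f 0 = f1 a * (t - 0).
  apply: MVT => // [x|]; last exact: continuous_subspaceT.
  by rewrite in_itv/= => /andP[x0 xt]; apply: df; rewrite x0 (lt_trans xt).
have [b /= + fb] : exists2 b, b \in `]t, 1[%R & f 1 - f t = f1 b * (1 - t).
  apply: MVT => // [x|]; last exact: continuous_subspaceT.
  by rewrite in_itv/= => /andP[xt x1]; apply: df; rewrite x1 (lt_trans _ xt).
rewrite !in_itv/= => /andP[tb b1] /andP[a0 at'].
have ab : a < b by exact: lt_trans tb.
have in01 x : a <= x <= b -> 0 < x < 1.
  by move=> /andP[ax xb]; rewrite (lt_le_trans a0 ax) (le_lt_trans xb b1).
have [c /= + fc1] : exists2 c, c \in `]a, b[%R & f1 b - f1 a = f2 c * (b - a).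
  apply: MVT => // [x|].
    by rewrite in_itv/= => /andP[ax xb]; apply/df1/in01; rewrite !ltW.
  apply: derivable_within_continuous => x; rewrite in_itv/= => /in01 x01.
  exact: (@ex_derive _ _ _ _ _ _ _ (df1 x x01)).
rewrite in_itv/= => /andP[ac cb].
have : 0 <= f2 c * (b - a).
  by rewrite mulr_ge0 ?subr_ge0 ?(ltW ab)// f2ge0// in01// !ltW.
rewrite -fc1 => f1ab.
have : 0 <= t * (1 - t) * (f1 b - f1 a).
  by rewrite !mulr_ge0// ?subr_ge0// ltW.
move: fa fb; rewrite subr0 => fa fb.
have -> : t * (1 - t) * (f1 b - f1 a)
   = t * (f1 b * (1 - t)) - (1 - t) * (f1 a * t) by ring.
by rewrite -fa -fb; lra.
Qed.

(** The Bregman divergence of x ln x between b and a. *)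
Definition entropy_jump (R : realType) (a b : R) : R := b * (ln b - ln a) - b + a.

Lemma ln_sub_le (R : realType) (a b : R) : 0 < a -> 0 < b -> ln a - ln b <= a / b - 1.
Proof.
move=> a0 b0; rewrite -ln_div ?posrE//.
have := @le_ln1Dx R (a / b - 1); rewrite subrKC; apply.
by rewrite ltrBrDr addrC subrr divr_gt0.
Qed.

(** The Bochner inequality behind the convexity: the values p, q, r, w of u at
    four consecutive vertices, in either orientation. The left side is the
    derivative of J(q, r) along the heat equation, the right side the Laplacian of
    J. Their difference is
    w (X - 1 - ln X) + q (Y - 1 - ln Y) with X = r^2 / (w q), Y = p r / q^2. *)
Lemma entropy_jump_bochner (R : realType) (p q r w : R) :
  0 < p -> 0 < q -> 0 < r -> 0 < w ->
  (q + w - 2 * r) * (ln r - ln q) + (p + r - 2 * q) * (1 - r / q)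
  <= entropy_jump r w + entropy_jump p q - 2 * entropy_jump q r.
Proof.
move=> p0 q0 r0 w0; rewrite -subr_ge0.
have h1 := ln_sub_le (mulr_gt0 r0 r0) (mulr_gt0 w0 q0).
have h2 := ln_sub_le (mulr_gt0 p0 r0) (mulr_gt0 q0 q0).
rewrite !lnM ?posrE// in h1 h2.
have k1 : 0 <= w * (r * r / (w * q) - 1 - (ln r + ln r - (ln w + ln q))).
  by rewrite mulr_ge0 ?subr_ge0// ltW.
have k2 : 0 <= q * (p * r / (q * q) - 1 - (ln p + ln r - (ln q + ln q))).
  by rewrite mulr_ge0 ?subr_ge0// ltW.
apply: (le_trans (addr_ge0 k1 k2)); rewrite le_eqVlt; apply/orP; left; apply/eqP.
by rewrite /entropy_jump; field; rewrite !gt_eqF.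
Qed.

Definition cycle_laplacian (R : realType) (N : nat) (h : 'Z_N -> R) (z : 'Z_N) : R :=
  h (z + 1) + h (z - 1) - 2 * h z.

Lemma sum_cycle_laplacian (R : realType) (N : nat) (a b : 'Z_N -> R) :
  \sum_z cycle_laplacian a z * b z = \sum_z a z * cycle_laplacian b z.
Proof.
have shift s : \sum_z a (z + s) * b z = \sum_z a z * b (z - s).
  rewrite [RHS](reindex_inj (addIr s)); apply: eq_bigr => z _.
  by rewrite addrK.
rewrite /cycle_laplacian.
under eq_bigr do rewrite mulrBl mulrDl.
under [RHS]eq_bigr do rewrite mulrBr mulrDr.
rewrite !sumrB !big_split/= !shift opprK.
congr (_ - _); first by rewrite addrC.
by apply: eq_bigr => z _; ring.
Qed.

Lemma is_derive_entropy_jump (R : realType) (a b : R -> R) (t da db : R) :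
  0 < a t -> 0 < b t -> is_derive t 1 a da -> is_derive t 1 b db ->
  is_derive t 1 (fun s => entropy_jump (a s) (b s))
    (db * (ln (b t) - ln (a t)) + da * (1 - b t / a t)).
Proof.
move=> a0 b0 Da Db.
have La := is_derive1_comp (is_derive1_ln a0) Da.
have Lb := is_derive1_comp (is_derive1_ln b0) Db.
have D := is_deriveD (is_deriveB (is_deriveM Db (is_deriveB Lb La)) Db) Da.
apply: (is_derive_eq D).
rewrite /GRing.scale/= !fctE/=.
by field; rewrite !gt_eqF.
Qed.

Section HalfEntropy.
Variables (R : realType) (N : nat) (gamma : R) (u v : R -> 'Z_N -> R).
Hypothesis du : forall (t : R) (z : 'Z_N),
  is_derive t 1 (u^~ z) (gamma * cycle_laplacian (u t) z).
Hypothesis dv : forall (t : R) (z : 'Z_N),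
  is_derive t 1 (v^~ z) (- gamma * cycle_laplacian (v t) z).
Hypothesis u_gt0 : forall (t : R) (z : 'Z_N), 0 < t < 1 -> 0 < u t z.
Hypothesis v_gt0 : forall (t : R) (z : 'Z_N), 0 < t < 1 -> 0 < v t z.

(** The part of the entropy of the product u v that carries ln u. *)
Definition half_entropy (t : R) : R := \sum_z v t z * xlnx (u t z).

(** The derivative of the half entropy is - gamma times the sum of this
    quantity against v. *)
Definition jump_cost (t : R) (z : 'Z_N) : R :=
  entropy_jump (u t z) (u t (z + 1)) + entropy_jump (u t z) (u t (z - 1)).

(** The derivative of the jump cost, as a function of u, in the direction
    of the Laplacian of u. *)
Definition jump_cost_deriv (t : R) (z : 'Z_N) : R :=
  let J s := cycle_laplacian (u t) (z + s) * (ln (u t (z + s)) - ln (u t z))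
             + cycle_laplacian (u t) z * (1 - u t (z + s) / u t z) in
  J 1 + J (- 1).

(** Moving the Laplacian from v to u ln u leaves the difference
    (1 + ln u) Delta u - Delta (u ln u), which is minus the jump cost. *)
Lemma is_derive_half_entropy (t : R) : 0 < t < 1 ->
  is_derive t 1 half_entropy (- gamma * \sum_z v t z * jump_cost t z).
Proof.
move=> t01.
have D z := is_deriveM (dv t z)
  (is_deriveM (du t z) (is_derive1_comp (is_derive1_ln (u_gt0 z t01)) (du t z))).
apply: (is_derive_eq (is_derive_finsum D)).
under eq_bigr => z _ do rewrite /GRing.scale/=.
have E z : v t z * (u t z * ((u t z)^-1 * (gamma * cycle_laplacian (u t) z))
     + ln (u t z) * (gamma * cycle_laplacian (u t) z))
   + u t z * ln (u t z) * (- gamma * cycle_laplacian (v t) z)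
  = gamma * (v t z * cycle_laplacian (u t) z * (1 + ln (u t z)))
    - gamma * (cycle_laplacian (v t) z * xlnx (u t z)).
  by rewrite /xlnx; field; rewrite gt_eqF ?u_gt0.
rewrite (eq_bigr _ (fun z _ => E z)).
rewrite sumrB -!mulr_sumr sum_cycle_laplacian -mulrBr -sumrB mulNr -mulrN -sumrN.
congr (_ * _); apply: eq_bigr => z _.
by rewrite /jump_cost /entropy_jump /cycle_laplacian /xlnx; ring.
Qed.

(** Again the Laplacian is moved from v to the factor that depends on u. *)
Lemma is_derive_half_entropy2 (t : R) : 0 < t < 1 ->
  is_derive t 1 (fun s => - gamma * \sum_z v s z * jump_cost s z)
    (gamma ^+ 2 * \sum_z v t z
       * (cycle_laplacian (jump_cost t) z - jump_cost_deriv t z)).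
Proof.
move=> t01.
have DJ z : is_derive t 1 (jump_cost^~ z) (gamma * jump_cost_deriv t z).
  have D1 s := is_derive_entropy_jump (u_gt0 z t01) (u_gt0 (z + s) t01)
                 (du t z) (du t (z + s)).
  apply: (is_derive_eq (is_deriveD (D1 1) (D1 (- 1)))).
  by rewrite /jump_cost_deriv; ring.
have D z := is_deriveM (dv t z) (DJ z).
apply: (is_derive_eq (is_deriveM (is_derive_cst (- gamma) t 1) (is_derive_finsum D))).
rewrite /GRing.scale/= mulr0 addr0.
have E z : v t z * (gamma * jump_cost_deriv t z)
   + jump_cost t z * (- gamma * cycle_laplacian (v t) z)
  = - gamma * (cycle_laplacian (v t) z * jump_cost t z
               - v t z * jump_cost_deriv t z) by ring.
rewrite (eq_bigr _ (fun z _ => E z)).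
rewrite -mulr_sumr sumrB sum_cycle_laplacian -sumrB mulrA -expr2 sqrrN.
by congr (_ * _); apply: eq_bigr => z _; rewrite [RHS]mulrBr.
Qed.

Lemma half_entropy_deriv2_ge0 (t : R) : 0 < t < 1 ->
  0 <= gamma ^+ 2 * \sum_z v t z
       * (cycle_laplacian (jump_cost t) z - jump_cost_deriv t z).
Proof.
move=> t01; rewrite mulr_ge0 ?sqr_ge0//; apply: sumr_ge0 => z _.
rewrite mulr_ge0 ?(ltW (v_gt0 _ t01))// subr_ge0.
have U w := u_gt0 w t01.
have hp := entropy_jump_bochner (U (z - 1)) (U z) (U (z + 1)) (U (z + 1 + 1)).
have hm := entropy_jump_bochner (U (z + 1)) (U z) (U (z - 1)) (U (z - 1 - 1)).
rewrite /jump_cost_deriv /jump_cost /cycle_laplacian !subrK !addrK.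
move: hp hm; lra.
Qed.

Lemma half_entropy_le_chord (t : R) : 0 < t < 1 ->
  half_entropy t <= (1 - t) * half_entropy 0 + t * half_entropy 1.
Proof.
move=> t01; apply: (le_chord t01 _ is_derive_half_entropy
  is_derive_half_entropy2 half_entropy_deriv2_ge0).
have cu (w : R -> R) (dw : R -> R) : (forall s : R, is_derive s 1 w (dw s)) -> continuous w.
  move=> Dw s; apply/differentiable_continuous/derivable1_diffP.
  exact: (@ex_derive _ _ _ _ _ _ _ (Dw s)).
move=> s; apply: cvg_finsum => z; apply: cvgM; first exact: (cu _ _ (dv^~ z)).
by apply: continuous_comp; [exact: (cu _ _ (du^~ z)) | exact: xlnx_continuous].
Qed.

End HalfEntropy.

(** * Schrodinger bridges and the zero temperature limit *)

Lemma cvg_exprn_at_right0 (R : realType) (k : nat) :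
  g ^+ k @[g --> (0 : R)^'+] --> ((k == 0%N)%:R : R).
Proof.
rewrite -expr0n; exact: (cvg_at_right_filter (@exprn_continuous R k 0)).
Qed.

(** Short-time asymptotics of the three kernels leave the factor
    gamma^(d(x,z) + d(z,y) - d(x,y)), whose limit is the indicator of the geodesic
    interval; the three factorials form the binomial coefficient. *)
Lemma pinned_bridge_cvg (R : realType) (N : nat) (t : R) (x y z : 'Z_N) :
  0 < t < 1 ->
  semigroup R N gamma t x z * semigroup R N gamma (1 - t) z y
    / semigroup R N gamma 1 x y @[gamma --> (0 : R)^'+] --> pinned_bridge x y t z.
Proof.
move=> /andP[t0 t1]; have s0 : 0 < 1 - t by rewrite subr_gt0.
pose a := cycle_dist x z; pose b := cycle_dist z y; pose c := cycle_dist x y.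
have cab : (c <= a + b)%N := cycle_dist_triangle x z y.
pose L (k : nat) (i j : 'Z_N) := (cycle_gen R N ^+ k) i j.
have Lc0 : L c x y != 0 by rewrite gt_eqF// cycle_gen_power_dist_gt0.
have fact0 k : (k`!%:R : R) != 0 by rewrite pnatr_eq0 -lt0n fact_gt0.
have -> : pinned_bridge x y t z
  = t ^+ a * (L a x z / a`!%:R) * ((1 - t) ^+ b * (L b z y / b`!%:R))
    * (1 ^+ c * (L c x y / c`!%:R))^-1 * (a + b - c == 0)%N%:R.
  rewrite /pinned_bridge inE /= -/a -/b -/c -/(L a x z) -/(L b z y) -/(L c x y).
  rewrite subn_eq0 eqn_leq cab andbT.
  case: (leqP (a + b) c) => [abc|_]; last by rewrite mulr0 !mul0r.
  have E : c = (a + b)%N by apply/eqP; rewrite eqn_leq cab.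
  have := bin_fact (leq_addr b a); rewrite addKn -E => /(congr1 (fun n => n%:R : R)).
  rewrite !natrM => <-; rewrite expr1n.
  by field; rewrite Lc0 !fact0 pnatr_eq0 -lt0n bin_gt0 [in leqRHS]E leq_addr.
have lead0 : (1 : R) ^+ c * (L c x y / c`!%:R) != 0.
  by rewrite expr1n mul1r mulf_neq0// invr_eq0.
have lim := cvgM (cvgM
  (cvgM (@heat_kernel_leading R N t x z t0) (@heat_kernel_leading R N (1 - t) z y s0))
  (cvgV lead0 (@heat_kernel_leading R N 1 x y ltr01))) (@cvg_exprn_at_right0 R (a + b - c)).
apply: cvg_trans (_ : _ --> _); last exact: lim.
apply: near_eq_cvg; near=> g.
have g0 : 0 < g by near: g; exact: nbhs_right_gt.
have gk k : g ^+ k != 0 by rewrite expf_neq0// gt_eqF.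
change (semigroup R N g t x z / g ^+ a * (semigroup R N g (1 - t) z y / g ^+ b)
   * (semigroup R N g 1 x y / g ^+ c)^-1 * g ^+ (a + b - c)
   = semigroup R N g t x z * semigroup R N g (1 - t) z y / semigroup R N g 1 x y).
rewrite !invfM invrK.
have E : g ^+ a * g ^+ b = g ^+ c * g ^+ (a + b - c) by rewrite -!exprD subnKC.
transitivity (semigroup R N g t x z * semigroup R N g (1 - t) z y
   / semigroup R N g 1 x y * ((g ^+ c * g ^+ (a + b - c)) / (g ^+ a * g ^+ b))).
  by rewrite invfM; ring.
by rewrite -E divff ?mulr1// mulf_neq0.
Unshelve. all: by end_near.
Qed.

Lemma heat_flow_gt0 (R : realType) (N : nat) (gamma t : R) (f : 'Z_N -> R)
    (z : 'Z_N) :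
  (forall x y : 'Z_N, 0 < semigroup R N gamma t x y) ->
  (forall x, 0 <= f x) -> (exists x, f x != 0) -> 0 < heat_flow gamma f t z.
Proof.
move=> P0 f0 [x fx]; rewrite /heat_flow /apply_mx (bigD1 x)//=.
rewrite ltr_pwDl//; first by rewrite mulr_gt0// lt_def fx f0.
by apply: sumr_ge0 => y _; rewrite mulr_ge0// ltW.
Qed.

(** Splitting of the entropy of the product density into two half entropies; it
    persists where a factor vanishes. *)
Lemma xlnxM (R : realType) (a b : R) : 0 <= a -> 0 <= b ->
  xlnx (a * b) = b * xlnx a + a * xlnx b.
Proof.
rewrite /xlnx !le_eqVlt => /predU1P[<-|a0] /predU1P[<-|b0];
  rewrite ?(mul0r, mulr0, addr0)//.
by rewrite lnM ?posrE//; ring.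
Qed.

Lemma relative_entropy_unif (R : realType) (N : nat) (q : 'Z_N -> R) :
  (0 < N)%N ->
  relative_entropy q (cycle_unif R N) = N%:R^-1 * \sum_z xlnx (q z / cycle_unif R N z).
Proof.
move=> N0; rewrite /relative_entropy mulr_sumr; apply: eq_bigr => z _.
rewrite /xlnx /cycle_unif invrK; field.
by rewrite pnatr_eq0 -lt0n.
Qed.

Definition schrodinger_half_entropy (R : realType) (N : nat) (gamma : R)
    (f g : 'Z_N -> R) : R -> R :=
  half_entropy (heat_flow gamma f) (fun s => heat_flow gamma g (1 - s)).

Lemma schrodinger_half_entropy_le_chord (R : realType) (N : nat) (gamma t : R)
    (f g : 'Z_N -> R) : (3 <= N)%N -> 0 < t < 1 ->
  (forall s : R, 0 < s <= 1 -> forall x y : 'Z_N, 0 < semigroup R N gamma s x y) ->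
  (forall x, 0 <= f x) -> (forall x, 0 <= g x) ->
  (exists x, f x != 0) -> (exists x, g x != 0) ->
  schrodinger_half_entropy gamma f g t
  <= (1 - t) * schrodinger_half_entropy gamma f g 0
     + t * schrodinger_half_entropy gamma f g 1.
Proof.
move=> hN t01 P0 f0 g0 fn gn; apply: (@half_entropy_le_chord R N gamma (heat_flow gamma f)
  (fun s => heat_flow gamma g (1 - s)) _ _ _ _ t t01).
- by move=> s z; exact: is_derive_heat_flow.
- move=> s z.
  have D1 : is_derive s 1 (fun r : R => 1 - r) (0 - 1).
    exact: (is_deriveB (is_derive_cst (1 : R) s 1) (is_derive_id s 1)).
  have D2 := @is_derive1_comp R (fun r => heat_flow gamma g r z) (fun r => 1 - r) s _ _
    (is_derive_heat_flow gamma (1 - s) g z hN) D1.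
  apply: (is_derive_eq D2).
  by rewrite /cycle_laplacian sub0r mulrN1 mulNr.
- move=> s z /andP[s0 s1]; apply: heat_flow_gt0 => //; apply: P0.
  by rewrite s0 ltW.
- move=> s z /andP[s0 s1]; apply: heat_flow_gt0 => //; apply: P0.
  by rewrite subr_gt0 s1 gerBl ltW.
Qed.

(** The half entropies of (f, g) at t and of (g, f) at 1 - t add up to the
    entropy of the bridge. At the endpoints one of the two flows is the identity,
    and the Schrodinger system identifies the product with nu0 / mu or nu1 / mu. *)
Lemma schrodinger_entropy_le_chord (R : realType) (N : nat) (gamma t : R)
    (nu0 nu1 f g : 'Z_N -> R) : (3 <= N)%N -> 0 < t < 1 ->
  (forall s : R, 0 < s <= 1 -> forall x y : 'Z_N, 0 < semigroup R N gamma s x y) ->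
  is_prob nu0 -> schrodinger_system gamma nu0 nu1 f g ->
  relative_entropy (fun z => heat_flow gamma f t z * heat_flow gamma g (1 - t) z
                             * cycle_unif R N z) (cycle_unif R N)
  <= (1 - t) * relative_entropy nu0 (cycle_unif R N)
     + t * relative_entropy nu1 (cycle_unif R N).
Proof.
move=> hN t01 P0 [_ nu01] [f0 g0 sys0 sys1].
have N0 : (0 < N)%N by exact: leq_trans hN.
have unif0 z : cycle_unif R N z != 0 by rewrite invr_eq0 pnatr_eq0 -lt0n.
have nonzero : exists x, nu0 x != 0.
  apply: contrapT => no; have : \sum_x nu0 x = 0.
    by apply: big1 => x _; apply/eqP/negPn/negP => nx; apply: no; exists x.
  by rewrite nu01 => /eqP; rewrite oner_eq0.
have [x0 nx0] := nonzero.
(* nu0 has a positive value, so neither f nor g is identically zero. *)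
have prod0 : f x0 * apply_mx (semigroup R N gamma 1) g x0 != 0.
  by rewrite sys0 mulf_neq0// invr_eq0.
have fn : exists x, f x != 0.
  by exists x0; move: prod0; rewrite mulf_eq0 negb_or => /andP[].
have gn : exists x, g x != 0.
  apply: contrapT => no; move: prod0; rewrite mulf_eq0 negb_or => /andP[_ /eqP].
  apply; apply: big1 => y _; have -> : g y = 0; last by rewrite mulr0.
  by apply/eqP/negPn/negP => ny; apply: no; exists y.
have [t0 t1] := andP t01.
have flow0 (h : 'Z_N -> R) (s : R) z :
    (forall x, 0 <= h x) -> 0 <= s <= 1 -> 0 <= heat_flow gamma h s z.
  move=> h0 /andP[]; rewrite le_eqVlt => /predU1P[<- _|s0 s1]; first by rewrite heat_flow0.
  by apply: sumr_ge0 => y _; apply: mulr_ge0 => //; apply: ltW; apply: P0; rewrite s0.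
pose A := @schrodinger_half_entropy R N gamma.
pose E s := \sum_z xlnx (heat_flow gamma f s z * heat_flow gamma g (1 - s) z).
have EA (s : R) : 0 <= s <= 1 -> E s = A f g s + A g f (1 - s).
  move=> s01; rewrite /E /A /schrodinger_half_entropy /half_entropy -big_split.
  apply: eq_bigr => z _ /=; rewrite subKr xlnxM ?flow0//.
  by move: s01 => /andP[s0 s1]; rewrite subr_ge0 s1 gerBl.
have t01' : 0 < 1 - t < 1 by rewrite subr_gt0 t1 gtrBl.
have chord : E t <= (1 - t) * E 0 + t * E 1.
  have h1 : A f g t <= (1 - t) * A f g 0 + t * A f g 1.
    exact: schrodinger_half_entropy_le_chord.
  have h2 : A g f (1 - t) <= t * A g f 0 + (1 - t) * A g f 1.
    by rewrite -[X in X * A g f 0](subKr 1); exact: schrodinger_half_entropy_le_chord.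
  rewrite !EA ?ler01 ?lexx ?(ltW t0) ?(ltW t1)// subr0 subrr.
  by clearbody A; clear - h1 h2; lra.
rewrite !relative_entropy_unif//.
have -> : \sum_z xlnx (nu0 z / cycle_unif R N z) = E 0.
  by apply: eq_bigr => z _; rewrite -sys0 heat_flow0 subr0.
have -> : \sum_z xlnx (nu1 z / cycle_unif R N z) = E 1.
  by apply: eq_bigr => z _; rewrite -sys1 subrr heat_flow0 mulrC.
have -> : \sum_z xlnx (heat_flow gamma f t z * heat_flow gamma g (1 - t) z
                       * cycle_unif R N z / cycle_unif R N z) = E t.
  by apply: eq_bigr => z _; rewrite mulfK.
have Ninv : 0 <= (N%:R^-1 : R) by rewrite invr_ge0.
clearbody E; apply: (le_trans (ler_wpM2l Ninv chord)).
by rewrite le_eqVlt; apply/orP; left; apply/eqP; ring.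
Qed.

(** Disintegration of the bridge over its endpoints. *)
Lemma schrodinger_bridge_sum (R : realType) (N : nat) (gamma t : R)
    (f g : 'Z_N -> R) (z : 'Z_N) :
  (forall x y : 'Z_N, 0 < semigroup R N gamma 1 x y) ->
  heat_flow gamma f t z * heat_flow gamma g (1 - t) z * cycle_unif R N z
  = \sum_x \sum_y semigroup R N gamma t x z * semigroup R N gamma (1 - t) z y
      / semigroup R N gamma 1 x y * schrodinger_coupling gamma f g x y.
Proof.
move=> P0; rewrite /heat_flow /apply_mx mulr_suml mulr_suml.
apply: eq_bigr => x _; rewrite mulr_sumr mulr_suml; apply: eq_bigr => y _.
rewrite /schrodinger_coupling /cycle_unif [semigroup _ _ _ t z x]heat_kernel_sym.
have := P0 x y; set p := semigroup R N gamma 1 x y => p0.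
set a := semigroup _ _ _ t _ _; set b := semigroup _ _ _ _ _ _.
rewrite [RHS](_ : _ = a * b * f x * g y * N%:R^-1 * (p / p)); last by ring.
by rewrite divff ?gt_eqF//; ring.
Qed.

Theorem theorem2p6 (R : realType) (N : nat) (hN : (3 <= N)%N)
    (nu0 nu1 : 'Z_N -> R) (hnu0 : is_prob nu0) (hnu1 : is_prob nu1)
    (Qhat : R -> 'Z_N -> R)
    (hQ : is_zero_temperature_bridge nu0 nu1 Qhat)
    (t : R) (ht : 0 < t < 1) :
  relative_entropy (Qhat t) (cycle_unif R N)
    <= (1 - t) * relative_entropy nu0 (cycle_unif R N)
       + t * relative_entropy nu1 (cycle_unif R N).
Proof.
have [pihat [[f [g [sys pi_cvg]]] QE]] := hQ.
have N0 : (0 < N)%N by exact: leq_trans hN.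
have [g0 g0_gt0 P0] := heat_kernel_gt0 R N.
pose Q gamma z := heat_flow gamma (f gamma) t z * heat_flow gamma (g gamma) (1 - t) z
                  * cycle_unif R N z.
have small : \forall gamma \near (0 : R)^'+, 0 < gamma < g0.
  near=> gamma; apply/andP; split; near: gamma; first exact: nbhs_right_gt.
  exact: nbhs_right_lt.
have Q_cvg z : Q gamma z @[gamma --> (0 : R)^'+] --> Qhat t z.
  have [t0 t1] := andP ht; rewrite QE ?(ltW t0) ?(ltW t1)//.
  have lim : \sum_x \sum_y semigroup R N gamma t x z * semigroup R N gamma (1 - t) z y
        / semigroup R N gamma 1 x y
        * schrodinger_coupling gamma (f gamma) (g gamma) x y @[gamma --> (0 : R)^'+]
      --> \sum_x \sum_y pinned_bridge x y t z * pihat x y.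
    apply: cvg_finsum => x; apply: cvg_finsum => y.
    by apply: cvgM; [exact: pinned_bridge_cvg | exact: pi_cvg].
  apply: cvg_trans lim.
  apply: near_eq_cvg; near=> gamma.
  have gs : 0 < gamma < g0 by near: gamma.
  by rewrite /Q schrodinger_bridge_sum// => x y; apply: P0; rewrite ?ltr01 ?lexx.
have H_cvg : relative_entropy (Q gamma) (cycle_unif R N) @[gamma --> (0 : R)^'+]
    --> relative_entropy (Qhat t) (cycle_unif R N).
  rewrite relative_entropy_unif//.
  under eq_cvg do rewrite relative_entropy_unif//.
  apply: cvgM; first exact: cvg_cst.
  apply: cvg_finsum => z.
  apply: (cvg_comp _ _ (cvgM (Q_cvg z) (cvg_cst (cycle_unif R N z)^-1))).
  exact: xlnx_continuous.
apply: (cvgr_to_le H_cvg); near=> gamma.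
have gs : 0 < gamma < g0 by near: gamma.
apply: (schrodinger_entropy_le_chord hN ht _ hnu0 (sys gamma _)).
- by move=> s s01; exact: P0.
- by case/andP: gs.
Unshelve. all: by end_near.
Qed.
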